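(* Let $\mathcal F$ be a group pair with $A$ as in the context, and suppose $A$ is closed under relational converse and relational composition. Then for all $(x,y),(y,z)\in\mathcal E$, $$\varphi_{xy}[H_{xy}\circ H_{xz}]=K_{xy}\circ H_{yz},\quad\varphi_{yz}[K_{xy}\circ H_{yz}]=K_{xz}\circ K_{yz},\quad\varphi_{xz}[H_{xy}\circ H_{xz}]=K_{xz}\circ K_{yz}.$$ In other words: (i) the map induced by $\varphi_{xy}$ maps $G_x/(H_{xy}\circ H_{xz})$ isomorphically onto $G_y/(K_{xy}\circ H_{yz})$; (ii) the map induced by $\varphi_{yz}$ maps $G_y/(K_{xy}\circ H_{yz})$ isomorphically onto $G_z/(K_{xz}\circ K_{yz})$; (iii) the map induced by $\varphi_{xz}$ maps $G_x/(H_{xy}\circ H_{xz})$ isomorphically onto $G_z/(K_{xz}\circ K_{yz})$.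
   Context: A group pair consists of the following data. - Pairwise disjoint groups $G_x$ ($x\in I$). - An equivalence relation $\mathcal E$ on $I$. - For each $(x,y)\in\mathcal E$, an isomorphism $\varphi_{xy}:G_x/H_{xy}\to G_y/K_{xy}$, where $H_{xy}\trianglelefteq G_x$ and $K_{xy}\trianglelefteq G_y$. $X\circ Y$ denotes the complex product. For each $(x,y)\in\mathcal E$ fix an enumeration without repetitions $\langle H_{xy,\gamma}:\gamma<\kappa_{xy}\rangle$ of the cosets of $H_{xy}$, with $H_{xy,0}=H_{xy}$, and put $K_{xy,\gamma}=\varphi_{xy}(H_{xy,\gamma})$. Define $R_{xy,\alpha}=\bigcup_{\gamma}H_{xy,\gamma}\times(K_{xy,\gamma}\circ K_{xy,\alpha})$, and let $A$ be the set of all unions of subfamilies of these relations. For $S\subseteq G_x$ a union of cosets of $H_{xy}$, $\varphi_{xy}[S]$ is the union of the images of the cosets contained in $S$. The map induced by $\varphi_{xy}$ on a quotient by a normal subgroup $N$ that is a union of cosets of $H_{xy}$ sends each coset $C$ of $N$ to $\varphi_{xy}[C]$. *)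

(* Defs.v *)
From HB Require Import structures.
From Corelib Require Import RelationClasses.
From mathcomp Require Import all_boot.
From mathcomp Require Import boolp classical_sets functions.

Set Implicit Arguments.
Unset Strict Implicit.
Unset Printing Implicit Defensive.

Local Open Scope classical_set_scope.
Local Open Scope group_scope.

(* The groups are possibly infinite, so subgroups, cosets and quotients are    *)
(* expressed with classical sets: a quotient group G / N is the set of cosets  *)
(* of N, with the complex product as multiplication.                           *)

Definition cprod (G : groupType) (X Y : set G) : set G :=
  [set x * y | x in X & y in Y].

Definition normal_subgroup (G : groupType) (N : set G) : Prop :=
  group_closed (mem N) /\ forall n g : G, N n -> N (n ^ g).

Definition cosets (G : groupType) (N : set G) : set (set G) :=
  [set cprod [set g] N | g in [set: G]].

(* f is only constrained on the cosets of N. *)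
Definition quotient_iso (G G' : groupType) (N : set G) (M : set G')
    (f : set G -> set G') : Prop :=
  [/\ normal_subgroup N, normal_subgroup M,
      set_bij (cosets N) (cosets M) f
    & {in cosets N &, {morph f : C D / cprod C D}}].

(* The set phi[S], for a map phi on the cosets of H. *)
Definition coset_image (G G' : groupType) (H : set G)
    (phi : set G -> set G') (S : set G) : set G' :=
  \bigcup_(C in [set C | cosets H C /\ C `<=` S]) phi C.

(* gpH, gpK and gphi are total in x and y, but are constrained (and used) only *)
(* at pairs related by gpE.                                                    *)
Unset Implicit Arguments.
Record group_pair := GroupPair {
  gpI : Type;
  grp : gpI -> groupType;
  gpE : gpI -> gpI -> Prop;
  gpH : forall x y : gpI, set (grp x);
  gpK : forall x y : gpI, set (grp y);
  gphi : forall x y : gpI, set (grp x) -> set (grp y);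
  gpE_equiv : Equivalence gpE;
  gphi_iso : forall x y, gpE x y ->
    quotient_iso (gpH x y) (gpK x y) (gphi x y)
}.
Arguments grp {g} x.
Arguments gpE {g} x y.
Arguments gpH {g} x y _.
Arguments gpK {g} x y _.
Arguments gphi {g} x y _ _.

(* An enumeration without repetitions of the cosets of each gpH x y; the       *)
(* ordinal kappa_xy is represented by a type of indices with a distinguished   *)
(* element.                                                                    *)
Record coset_enum (F : group_pair) := CosetEnum {
  kappa : gpI F -> gpI F -> Type;
  kappa0 : forall x y, kappa x y;
  Hc : forall x y, kappa x y -> set (grp x);
  Hc_bij : forall x y, gpE x y ->
    set_bij [set: kappa x y] (cosets (gpH x y)) (Hc x y);
  Hc0 : forall x y, gpE x y -> Hc x y (kappa0 x y) = gpH x y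
}.
Arguments kappa {F} c x y.
Arguments kappa0 {F} c x y.
Arguments Hc {F c x y} g _.
Set Implicit Arguments.

Section Relations.
Variables (F : group_pair) (c : coset_enum F).

Definition Kc (x y : gpI F) (g : kappa c x y) : set (grp y) :=
  gphi x y (Hc g).

(* The disjoint union of the groups. *)
Definition base : Type := {x : gpI F & grp x}.

Definition relR (x y : gpI F) (a : kappa c x y) : set (base * base) :=
  \bigcup_(g in [set: kappa c x y])
    [set (existT grp x p, existT grp y q)
      | p in Hc g & q in cprod (Kc g) (Kc a)].

Definition atomic_relations : set (set (base * base)) :=
  [set T | exists x y (a : kappa c x y), gpE x y /\ T = relR a].

Definition relA : set (set (base * base)) :=
  [set \bigcup_(T in J) T
    | J in [set J : set (set (base * base)) | J `<=` atomic_relations]].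

End Relations.

Definition closed_under_converse (U : Type) (B : set (set (U * U))) : Prop :=
  forall S, B S -> B (S^-1)%relation.

Definition closed_under_composition (U : Type) (B : set (set (U * U))) : Prop :=
  forall S T, B S -> B T -> B (S \; T)%relation.

(* Main.v *)
(** Write p ~ q for "φ_xy maps the coset of p to the coset of q"; this is the
    relation R_xy,0.  Every R_xz,α is a union of products of cosets, and the
    only one containing (1,1) is R_xz,0.  So a member of A containing a pair
    (1_x,1_z) contains all of R_xz,0.  Applied to the converse of R_xy,0, this
    gives φ_yx = φ_xy^-1, so H_yx = K_xy.  Applied to R_xy,0 ; R_yz,0, it gives,
    for every p in H_xz, some q in H_yz with p ~ q, hence
    φ_xy[H_xy H_xz] ⊆ K_xy H_yz.  The reverse inclusion is the same one for the
    triple (y,x,z), and the three equalities are one equality up to permuting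
    x, y, z. *)

Require Import Defs.
From mathcomp Require Import all_boot.
From mathcomp Require Import boolp classical_sets functions.

Set Implicit Arguments.
Unset Strict Implicit.
Unset Printing Implicit Defensive.

Local Open Scope classical_set_scope.
Local Open Scope group_scope.

(** * Normal subgroups, cosets and complex products *)

Section Cosets.
Variable G : groupType.
Implicit Types (N M C : set G) (g h : G).

Lemma normal_subgroupP N : normal_subgroup N <->
  [/\ N 1, forall g h, N g -> N h -> N (g * h^-1)
    & forall n g, N n -> N (n ^ g)].
Proof.
rewrite /normal_subgroup; split.
  move=> [[N1 NB] NJ]; split => //; first exact: set_mem.
  by move=> g h Ng Nh; apply: set_mem; apply: NB; apply: mem_set.
move=> [N1 NB NJ]; split => //; split; first exact: mem_set.
by move=> g h /set_mem Ng /set_mem Nh; apply: mem_set; apply: NB.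
Qed.

Section Normal.
Variable N : set G.
Hypothesis nN : normal_subgroup N.

Lemma normal1 : N 1.
Proof. by case/normal_subgroupP: nN. Qed.

Lemma normalV g : N g -> N g^-1.
Proof.
by case/normal_subgroupP: nN => N1 NB _ Ng; rewrite -[g^-1]mul1g; apply: NB.
Qed.

Lemma normalM g h : N g -> N h -> N (g * h).
Proof.
move=> Ng /normalV Nh; rewrite -[h]invgK.
by case/normal_subgroupP: nN => _ NB _; apply: NB.
Qed.

Lemma normalJ n g : N n -> N (n ^ g).
Proof. by case: nN => _; apply. Qed.

Lemma lcosetP g h : cprod [set g] N h <-> N (g^-1 * h).
Proof.
split; first by move=> [_ -> [n Nn <-]]; rewrite mulKg.
by move=> Ngh; exists g => //; exists (g^-1 * h) => //; rewrite mulVKg.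
Qed.

Lemma lcoset_self g : cprod [set g] N g.
Proof. by apply/lcosetP; rewrite mulVg; apply: normal1. Qed.

Lemma lcoset1 : cprod [set 1] N = N.
Proof. by apply/seteqP; split => h /=; rewrite lcosetP invg1 mul1g. Qed.

Lemma lcoset_eq g h : N (g^-1 * h) -> cprod [set g] N = cprod [set h] N.
Proof.
move=> Ngh; apply/seteqP; split => k; rewrite !lcosetP => Nk.
  by have := normalM (normalV Ngh) Nk; rewrite invgM invgK -mulgA mulVKg.
by have := normalM Ngh Nk; rewrite -mulgA mulVKg.
Qed.

Lemma coset_lcoset C g : cosets N C -> C g -> C = cprod [set g] N.
Proof. by move=> [h _ <-] /lcosetP; apply: lcoset_eq. Qed.

Lemma lcoset_coset g : cosets N (cprod [set g] N).
Proof. by exists g. Qed.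

Lemma cprod_lcosets g h :
  cprod (cprod [set g] N) (cprod [set h] N) = cprod [set g * h] N.
Proof.
apply/seteqP; split => k.
  move=> [_ [_ -> [n Nn <-]] [_ [_ -> [m Nm <-]] <-]].
  apply/lcosetP; rewrite invgM -!mulgA mulKg mulgA mulgA -(mulgA h^-1).
  by rewrite -conjgE; apply: normalM => //; apply: normalJ.
move/lcosetP => Nk; exists g; first exact: lcoset_self.
by exists (g^-1 * k); [apply/lcosetP; rewrite mulgA -invgM | rewrite mulVKg].
Qed.

End Normal.

Lemma cprodC N M : normal_subgroup N -> cprod M N = cprod N M.
Proof.
move=> nN; apply/seteqP; split => _ [a Aa [b Bb <-]].
  exists (b ^ a^-1); first exact: normalJ.
  by exists a => //; rewrite -conjgCV.
by exists b => //; exists (a ^ b); [apply: normalJ | rewrite -conjgC].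
Qed.

Lemma normal_subgroup_cprod N M :
  normal_subgroup N -> normal_subgroup M -> normal_subgroup (cprod N M).
Proof.
move=> nN nM; apply/normal_subgroupP; split.
- exists 1; first exact: normal1.
  by exists 1; [apply: normal1 | rewrite mulg1].
- move=> _ _ [n Nn [m Mm <-]] [n' Nn' [m' Mm' <-]].
  exists (n * n'^-1); first by apply: normalM => //; apply: normalV.
  (* Moving [n'^-1] to the left past [m * m'^-1] conjugates the latter by [n'^-1]. *)
  exists ((m * m'^-1) ^ n'^-1).
    by apply: normalJ => //; apply: normalM => //; apply: normalV.
  by rewrite conjgE invgK invgM -!mulgA mulKg.
- move=> _ g [n Nn [m Mm <-]]; exists (n ^ g); first exact: normalJ.
  by exists (m ^ g); [apply: normalJ | rewrite conjMg].
Qed.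

End Cosets.

(** * Isomorphisms of quotients, seen as relations between elements *)

Section QuotientIso.
Variables (G G' : groupType) (H : set G) (K : set G').
Variable phi : set G -> set G'.

(** Trading cosets for representatives turns [phi] into a multiplicative relation, total on both
    sides, and coset computations into computations with elements. *)
Definition matched (p : G) (q : G') := phi (cprod [set p] H) q.

Hypothesis iso : quotient_iso H K phi.

Let nH : normal_subgroup H. Proof. by case: iso. Qed.
Let nK : normal_subgroup K. Proof. by case: iso. Qed.

Lemma phi_coset p : cosets K (phi (cprod [set p] H)).
Proof. by case: iso => _ _ [fun_phi _ _] _; apply: fun_phi; exists p. Qed.

Lemma phi_lcoset p q : matched p q -> phi (cprod [set p] H) = cprod [set q] K.
Proof. exact/(coset_lcoset nK)/phi_coset. Qed.

Lemma matched_total p : exists q, matched p q.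
Proof.
have [q _ pq] := phi_coset p; exists q; rewrite /matched -pq.
exact: lcoset_self.
Qed.

Lemma matched_surj q : exists p, matched p q.
Proof.
case: iso => _ _ [_ _ surj] _.
have [_ [p _ <-] pq] := surj _ (lcoset_coset K q).
by exists p; rewrite /matched pq; apply: lcoset_self.
Qed.

Lemma matchedM p p' q q' :
  matched p q -> matched p' q' -> matched (p * p') (q * q').
Proof.
move=> pq pq'; rewrite /matched -cprod_lcosets //; case: iso => _ _ _ ->.
- by exists q => //; exists q'.
- exact/mem_set/lcoset_coset.
- exact/mem_set/lcoset_coset.
Qed.

Lemma matched1l q : matched 1 q <-> K q.
Proof.
suff m11 : matched 1 1 by rewrite /matched (phi_lcoset m11) lcoset1.
(* If 1 is matched with [k], it is also matched with [k * k]; both lie in one coset of [K], so [k]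
   is in [K]. *)
have [k k1] := matched_total 1.
have := matchedM k1 k1; rewrite mulg1 {1}/matched (phi_lcoset k1).
rewrite lcosetP mulKg => Kk; rewrite /matched (phi_lcoset k1) lcosetP mulg1.
exact: normalV.
Qed.

Lemma matched1r p : matched p 1 <-> H p.
Proof.
have m11 : matched 1 1 by apply/matched1l; apply: normal1 nK.
split => [/phi_lcoset|Hp].
  rewrite -(phi_lcoset m11) => e; have [_ _ [_ inj _] _] := iso.
  rewrite -(lcoset1 H) -(inj _ _ _ _ e); first exact: lcoset_self.
  - exact/mem_set/lcoset_coset.
  - exact/mem_set/lcoset_coset.
rewrite /matched -(lcoset_eq nH (g := 1)) //.
by rewrite invg1 mul1g.
Qed.

Lemma matchedV p q : matched p q -> matched p^-1 q^-1.
Proof.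
(* Here [q * r] is matched with 1, so it lies in [K], and so does its inverse; multiplying [r] by
   that inverse leaves [q^-1]. *)
move=> pq; have [r pr] := matched_total p^-1.
have := matchedM pq pr; rewrite mulgV => /matched1l /(normalV nK) /matched1l.
by move=> /(matchedM pr); rewrite mulg1 invgM mulVKg.
Qed.

Lemma matched_inj p p' q : matched p q -> matched p' q -> H (p^-1 * p').
Proof.
by move=> /matchedV pq /(matchedM pq); rewrite mulVg => /matched1r.
Qed.

Lemma matched_fun p q q' : matched p q -> matched p q' -> K (q^-1 * q').
Proof.
by move=> /matchedV pq /(matchedM pq); rewrite mulVg => /matched1l.
Qed.

(** Stability under right multiplication by [H] means that the whole coset of each point of [S]
    stays inside [S]. *)
Lemma coset_imageE (S : set G) :
  (forall s h, S s -> H h -> S (s * h)) ->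
  coset_image H phi S = [set q | exists2 p, S p & matched p q].
Proof.
move=> SH; apply/seteqP; split => q /=.
  move=> [_ [[p _ <-] sub] pq]; exists p => //.
  exact/sub/lcoset_self.
move=> [p Sp pq]; exists (cprod [set p] H) => //; split.
  exact: lcoset_coset.
by move=> _ [_ -> [h Hh <-]]; apply: SH.
Qed.

(** This passes from an equality of images to an induced isomorphism. Matched elements lie in [N]
    and [M] simultaneously, so the coset of [p] goes to the coset of any [q] matched with [p]; the
    isomorphism laws are then those of [matched]. *)
Lemma coset_image_iso (N : set G) (M : set G') :
  normal_subgroup N -> normal_subgroup M -> H `<=` N ->
  coset_image H phi N = M -> quotient_iso N M (coset_image H phi).
Proof.
move=> nN nM HN; rewrite coset_imageE; last first.
  by move=> s h Ns /HN; apply: normalM.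
move=> eqM.
have NM p q : N p -> matched p q -> M q by move=> Np pq; rewrite -eqM; exists p.
(* Some [p'] in [N] is matched with [q], and [p] differs from it by an element of [H], hence of
   [N]. *)
have MN p q : M q -> matched p q -> N p.
  rewrite -{1}eqM => -[p' Np' p'q] /(matched_inj p'q) /HN /(normalM nN Np').
  by rewrite mulVKg.
have imE p q : matched p q ->
    coset_image H phi (cprod [set p] N) = cprod [set q] M.
  move=> pq; rewrite coset_imageE; last first.
    move=> s h /lcosetP sN /HN Nh; apply/lcosetP; rewrite mulgA.
    exact: normalM.
  apply/seteqP; split => r /=.
    move=> [s /lcosetP Ns sr]; apply/lcosetP; apply: NM Ns _.
    exact/matchedM/sr/matchedV.
  move/lcosetP => Mr; have [s sr] := matched_surj r; exists s => //.
  by apply/lcosetP; apply: MN Mr _; apply: matchedM => //; apply: matchedV.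
split=> //; [split|].
- move=> _ [p _ <-]; have [q pq] := matched_total p.
  by rewrite (imE _ _ pq); exists q.
- move=> _ _ /set_mem[p _ <-] /set_mem[p' _ <-].
  have [q pq] := matched_total p; have [q' p'q'] := matched_total p'.
  rewrite (imE _ _ pq) (imE _ _ p'q') => e.
  have := lcoset_self nM q'; rewrite -e => /lcosetP Mqq'.
  apply: lcoset_eq => //; apply: MN Mqq' _; apply: matchedM => //.
  exact: matchedV.
- move=> _ [q _ <-]; have [p pq] := matched_surj q.
  by exists (cprod [set p] N); [exists p | apply: imE].
- move=> _ _ /set_mem[p _ <-] /set_mem[p' _ <-].
  have [q pq] := matched_total p; have [q' p'q'] := matched_total p'.
  rewrite cprod_lcosets // (imE _ _ pq) (imE _ _ p'q') cprod_lcosets //.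
  exact/imE/matchedM.
Qed.

End QuotientIso.

Arguments matched {G G'} H phi p q.

(** Proof irrelevance makes the equality proof [x = x] trivial, for an arbitrary index type. *)
Lemma existT_inj (I : Type) (T : I -> Type) (x : I) (p q : T x) :
  existT T x p = existT T x q -> p = q.
Proof.
move=> e; have := projT2_eq e.
by rewrite (Prop_irrelevance (projT1_eq e) erefl).
Qed.

Arguments gphi_iso {g x y} _.
Arguments Hc_bij {F} c {x y} _.
Arguments Hc0 {F} c {x y} _.

(** * The relations in A and the pairs of identities they contain *)

Section GroupPair.
Variables (F : group_pair) (c : coset_enum F).
Implicit Types x y z : gpI F.

Let related {x y} := matched (gpH x y) (gphi x y).

Lemma relR_sub x y (a : kappa c x y) : gpE x y ->
  relR a (existT grp x 1, existT grp y 1) ->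
  forall p q, related p q -> relR a (existT grp x p, existT grp y q).
Proof.
move=> xy [g _ [p0 Hp0 [q0 Kq0 [ep eq]]]] p q pq.
have iso := gphi_iso xy; have [nH nK _ _] := iso.
have [Hfun _ Hsurj] := Hc_bij c xy.
rewrite (existT_inj ep) (existT_inj eq) in Hp0 Kq0.
(* Since [Hc g] contains 1, [Kc g] is [K]. So 1 is a product of some [q1] in [K] and [q2] in [Kc a],
   and [q2 * q1 = 1] stays in the coset [Kc a]. *)
have Ka1 : Kc a 1.
  move: Kq0; rewrite /Kc (coset_lcoset nH (Hfun g I) Hp0).
  have [t _ <-] := Hfun a I; move=> [q1 /(matched1l iso) Kq1 [q2 tq2 q12]].
  have := matchedM iso tq2 (proj2 (matched1l iso q1) Kq1).
  by rewrite mulg1 -(mulg1_eq q12) mulVg.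
(* With [b] the index of the coset of [p], the factorization [q = q * 1] puts [q] in the product of
   [Kc b] and [Kc a]. *)
have [b _ eb] := Hsurj _ (lcoset_coset (gpH x y) p).
exists b => //; exists p; first by rewrite eb; apply: lcoset_self.
exists q => //; exists q; first by rewrite /Kc eb.
by exists 1 => //; rewrite mulg1.
Qed.

Lemma relA_sub (S : set (base F * base F)) x y : relA c S ->
  S (existT grp x 1, existT grp y 1) ->
  forall p q, related p q -> S (existT grp x p, existT grp y q).
Proof.
move=> [J Jat <-] [T JT]; have [x' [y' [a [x'y' eT]]]] := Jat _ JT.
move=> T11 p q pq; exists T => //; move: T11; rewrite eT => T11.
(* The union [base] is disjoint, so the atomic relation holding the pair of identities is indexed by
   [x] and [y] themselves. *)
have [g _ [p0 _ [q0 _ [ex _ ey _]]]] := T11.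
by subst x' y'; apply: relR_sub.
Qed.

Lemma related11 x y : gpE x y -> @related x y 1 1.
Proof.
move=> xy; have iso := gphi_iso xy; have [_ nK _ _] := iso.
by apply: (proj2 (matched1l iso 1)); apply: normal1 nK.
Qed.

Lemma relR0E x y p q : gpE x y ->
  relR (kappa0 c x y) (existT grp x p, existT grp y q) <-> related p q.
Proof.
move=> xy; have iso := gphi_iso xy; have [nH nK _ _] := iso.
have m11 := related11 xy.
have K0 : Kc (kappa0 c x y) = gpK x y.
  by rewrite /Kc (Hc0 c xy) -(lcoset1 (gpH x y)) (phi_lcoset iso m11) lcoset1.
split.
  move=> [g _ [p0 Hp0 [q0 Kq0 [ep eq]]]].
  rewrite (existT_inj ep) (existT_inj eq) K0 in Hp0 Kq0.
  have [Hfun _ _] := Hc_bij c xy.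
  move: Kq0; rewrite /Kc (coset_lcoset nH (Hfun g I) Hp0).
  move=> [q1 pq1 [k /(matched1l iso) Kk <-]].
  by have := matchedM iso pq1 Kk; rewrite mulg1.
(* Only the pair of identities remains to be placed in the relation. *)
apply: relR_sub => //; have [_ _ Hsurj] := Hc_bij c xy.
have [b _ eb] := Hsurj _ (lcoset_coset (gpH x y) 1).
exists b => //; exists 1; first by rewrite eb; apply: lcoset_self.
exists 1 => //; exists 1; first by rewrite /Kc eb.
by exists 1; [rewrite K0; apply: normal1 | rewrite mulg1].
Qed.

Lemma relR_in_relA x y (a : kappa c x y) : gpE x y -> relA c (relR a).
Proof.
move=> xy; exists [set relR a]; last exact: bigcup_set1.
by move=> _ ->; exists x, y, a.
Qed.

(** * Consequences of closure under converse and composition *)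

Hypothesis Aconv : closed_under_converse (relA c).
Hypothesis Acomp : closed_under_composition (relA c).

Lemma gpE_sym x y : gpE x y -> gpE y x.
Proof. by case: (gpE_equiv F) => _ + _; apply. Qed.

(** The converse of the 0-th relation from [y] to [x] is in A and contains the pair of identities,
    hence all matched pairs. *)
Lemma related_sym x y p q : gpE x y -> @related x y p q -> @related y x q p.
Proof.
move=> /gpE_sym yx pq; apply/(relR0E _ _ yx).
apply: (relA_sub (Aconv (relR_in_relA (kappa0 c y x) yx))) pq.
exact/(relR0E _ _ yx)/related11.
Qed.

(** Both sides consist of the elements matched with 1, which symmetry exchanges. *)
Lemma gpK_gpH x y : gpE x y -> gpK x y = gpH y x.
Proof.
move=> xy; have yx := gpE_sym xy; apply/seteqP; split => q.
  move/(matched1l (gphi_iso xy))/(related_sym xy).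
  by move/(matched1r (gphi_iso yx)).
move/(matched1r (gphi_iso yx))/(related_sym yx).
by move/(matched1l (gphi_iso xy)).
Qed.

Lemma related_comp x y z p r : gpE x y -> gpE y z ->
  @related x z p r -> exists2 q, @related x y p q & @related y z q r.
Proof.
move=> xy yz pr.
(* In [B \; A], the relation A is applied first. *)
have compA := Acomp (relR_in_relA (kappa0 c y z) yz)
                    (relR_in_relA (kappa0 c x y) xy).
have [|[w q] /= R1 R2] := relA_sub compA _ pr.
  by exists (existT grp y 1);
    [apply/(relR0E _ _ xy) | apply/(relR0E _ _ yz)]; apply: related11.
(* The intermediate point is a second coordinate of a relation from [x] to [y], so it lies in
   [grp y]. *)
have [g _ [p0 _ [q0 _ [_ ew _]]]] := R1; subst w.
by exists q; [apply/(relR0E _ _ xy) | apply/(relR0E _ _ yz)].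
Qed.

Lemma related_cprod x y z p q : gpE x y -> gpE y z ->
  cprod (gpH x y) (gpH x z) p -> @related x y p q ->
  cprod (gpK x y) (gpH y z) q.
Proof.
move=> xy yz; have xz : gpE x z.
  by case: (gpE_equiv F) => _ _ trans; apply: trans xy yz.
have ixy := gphi_iso xy; have [_ nK _ _] := ixy.
move=> [h /(matched1r ixy) h1 [k /(matched1r (gphi_iso xz)) k1 <-]] hkq.
(* The match of [k] with 1 in [grp z] factors through some [r], which lies in [gpH y z]. As [h] is
   matched with 1, both [r] and [q] are matched with [h * k], so they agree modulo [gpK x y]. *)
have [r kr /(matched1r (gphi_iso yz)) Hr] := related_comp xy yz k1.
have := matched_fun ixy (matchedM ixy h1 kr) hkq; rewrite mul1g => Kq.
by rewrite -cprodC //; exists r => //; exists (r^-1 * q); rewrite ?mulVKg.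
Qed.

Lemma coset_image_cprod x y z : gpE x y -> gpE y z ->
  coset_image (gpH x y) (gphi x y) (cprod (gpH x y) (gpH x z))
    = cprod (gpK x y) (gpH y z).
Proof.
move=> xy yz; have yx := gpE_sym xy.
have xz : gpE x z by case: (gpE_equiv F) => _ _ trans; apply: trans xy yz.
have ixy := gphi_iso xy; have [nH nK _ _] := ixy.
rewrite (coset_imageE ixy).
  apply/seteqP; split => q; first by move=> [p Hp]; apply: related_cprod.
  move=> Kq; have [p pq] := matched_surj ixy q; exists p => //.
  (* The reverse inclusion is the forward one for the triple [y], [x], [z]. *)
  rewrite -(gpK_gpH yx); apply: related_cprod (related_sym xy pq) => //.
  by rewrite -(gpK_gpH xy).
(* The product is a union of cosets of [gpH x y]: [k] moves left past [h'] at the cost of a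
   conjugation. *)
move=> _ k [h Hh [h' Hh' <-]] Hk; rewrite -mulgA (conjgCV h' k) mulgA.
exists (h * k ^ h'^-1); last by exists h'.
by apply: normalM => //; apply: normalJ.
Qed.

End GroupPair.

(** * The three equalities of images and the isomorphisms they induce *)

Theorem theorem3p13 (F : group_pair) (c : coset_enum F)
    (Aconv : closed_under_converse (relA c))
    (Acomp : closed_under_composition (relA c))
    (x y z : gpI F) (xy : gpE x y) (yz : gpE y z) :
  [/\ coset_image (gpH x y) (gphi x y) (cprod (gpH x y) (gpH x z))
        = cprod (gpK x y) (gpH y z),
      coset_image (gpH y z) (gphi y z) (cprod (gpK x y) (gpH y z))
        = cprod (gpK x z) (gpK y z)
    & coset_image (gpH x z) (gphi x z) (cprod (gpH x y) (gpH x z))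
        = cprod (gpK x z) (gpK y z)] /\
  [/\ quotient_iso (cprod (gpH x y) (gpH x z)) (cprod (gpK x y) (gpH y z))
        (coset_image (gpH x y) (gphi x y)),
      quotient_iso (cprod (gpK x y) (gpH y z)) (cprod (gpK x z) (gpK y z))
        (coset_image (gpH y z) (gphi y z))
    & quotient_iso (cprod (gpH x y) (gpH x z)) (cprod (gpK x z) (gpK y z))
        (coset_image (gpH x z) (gphi x z))].
Proof.
have [_ symE transE] := gpE_equiv F.
have xz := transE _ _ _ xy yz.
have [yx zx zy] := And3 (symE _ _ xy) (symE _ _ xz) (symE _ _ yz).
have ixy := gphi_iso xy; have iyz := gphi_iso yz; have ixz := gphi_iso xz.
have [[nHxy nKxy _ _] [nHyz nKyz _ _]] := (ixy, iyz).
have [nHxz nKxz _ _] := ixz.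
have e1 := coset_image_cprod Aconv Acomp xy yz.
(* The triples [y], [z], [x] and [x], [z], [y] give the other two equalities, once each reversed
   [gpH] is rewritten as a [gpK] and factors are commuted. *)
have e2 := coset_image_cprod Aconv Acomp yz zx.
rewrite -(gpK_gpH Aconv xy) -(gpK_gpH Aconv xz) cprodC // (cprodC _ nKxz) in e2.
have e3 := coset_image_cprod Aconv Acomp xz zy.
rewrite -(gpK_gpH Aconv yz) cprodC // in e3.
have subr (G : groupType) (N M : set G) : normal_subgroup N ->
    normal_subgroup M -> M `<=` cprod N M.
  move=> nN nM m Mm; exists 1; first exact: normal1.
  by exists m; rewrite ?mul1g.
split; split=> //.
- apply: (coset_image_iso ixy) => //; try exact: normal_subgroup_cprod.
  by rewrite (cprodC _ nHxz); apply: subr.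
- by apply: (coset_image_iso iyz) => //;
    [exact: normal_subgroup_cprod.. | apply: subr].
- by apply: (coset_image_iso ixz) => //;
    [exact: normal_subgroup_cprod.. | apply: subr].
Qed.
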